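(* Let $k$ be a field, let $A$ be a $k$-algebra, let $H$ be a weak Hopf algebra over $k$ with bijective antipode $S$, and let $\rho\colon H\otimes A\to A$, written $h\cdot a:=\rho(h\otimes a)$, and $\sigma\colon H\otimes_{H^R}H\to A$ be maps. Let $\varsigma:=\sigma\circ p$, where $p\colon H\otimes H\to H\otimes_{H^R}H$ is the canonical surjection. Assume that for all $h,k,m\in H$, $l\in H^L$ and $a,a'\in A$ the following conditions hold: (1) $h\cdot 1_A=\Pi^L(h)\cdot 1_A$; (2) $h\cdot(aa')=(h^{(1)}\cdot a)(h^{(2)}\cdot a')$; (3) $S^{-1}(l)h\cdot a=(h\cdot a)(l\cdot 1_A)$ and $lh\cdot a=(l\cdot 1_A)(h\cdot a)$; (4) $1\cdot a=a$; (5) $\sigma(lh,k)=(l\cdot 1_A)\sigma(h,k)$ and $\sigma(S^{-1}(l)h,k)=\sigma(h,k)(l\cdot 1_A)$; (6) $(h^{(1)}\cdot(l\cdot 1_A))\sigma(h^{(2)},k)=\sigma(h,lk)$; (7) $\sigma(1,h)=\sigma(h,1)=h\cdot 1_A$; (8) $(h^{(1)}\cdot\sigma(k^{(1)},m^{(1)}))\sigma(h^{(2)},k^{(2)}m^{(2)})=\sigma(h^{(1)},k^{(1)})\sigma(h^{(2)}k^{(2)},m)$; (9) $(h^{(1)}\cdot(k^{(1)}\cdot a))\sigma(h^{(2)},k^{(2)})=\sigma(h^{(1)},k^{(1)})(h^{(2)}k^{(2)}\cdot a)$; (10) $h\cdot(l\cdot 1_A)=hl\cdot 1_A$ (for $h\in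 H$, $l\in H^L$). Then for all $h,k,m\in H$ and $a,a'\in A$ the following hold: (2) $h\cdot(aa')=(h^{(1)}\cdot a)(h^{(2)}\cdot a')$; (4) $1\cdot a=a$; (11) $h\cdot(k\cdot 1_A)=hk\cdot 1_A$; (17) $(h^{(1)}\cdot\varsigma(k^{(1)}\otimes m^{(1)}))\varsigma(h^{(2)}\otimes k^{(2)}m^{(2)})=\varsigma(h^{(1)}\otimes k^{(1)})\varsigma(h^{(2)}k^{(2)}\otimes m)$; (18) $(h^{(1)}\cdot(k^{(1)}\cdot a))\varsigma(h^{(2)}\otimes k^{(2)})=\varsigma(h^{(1)}\otimes k^{(1)})(h^{(2)}k^{(2)}\cdot a)$; (19) $\varsigma(h\otimes k)=\varsigma(h^{(1)}\otimes k^{(1)})(h^{(2)}k^{(2)}\cdot 1_A)$; (20) $h\cdot 1_A=(h^{(1)}\cdot(1^{(1)}\cdot 1_A))\varsigma(h^{(2)}\otimes 1^{(2)})$; (21) $h\cdot 1_A=(1^{(1)}\cdot 1_A)\varsigma(1^{(2)}\otimes h)$; (22) $a(1^{(1)}\cdot 1_A)\otimes 1^{(2)}=1^{(1)}\cdot a\otimes 1^{(2)}$ in $A\otimes H$.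
   Context: Conventions: $\otimes=\otimes_k$, maps are $k$-linear, algebras are associative and unital. The Sweedler notation $\Delta(h)=h^{(1)}\otimes h^{(2)}$ (summation omitted) is used; in particular $\Delta(1)=1^{(1)}\otimes 1^{(2)}$, and primes denote a second copy of $\Delta(1)$. The expression $hk\cdot a$ means $(hk)\cdot a$. A weak bialgebra is a $k$-vector space $H$ with an algebra structure and a coalgebra structure (with comultiplication $\Delta$ and counit $\epsilon$) such that $\Delta(hl)=\Delta(h)\Delta(l)$, $\Delta^2(1)=1^{(1)}\otimes 1^{(2)}1^{(1')}\otimes 1^{(2')}=1^{(1)}\otimes 1^{(1')}1^{(2)}\otimes 1^{(2')}$ (where $\Delta^2=(\Delta\otimes \mathrm{id})\circ\Delta$), and $\epsilon(hlm)=\epsilon(hl^{(1)})\epsilon(l^{(2)}m)=\epsilon(hl^{(2)})\epsilon(l^{(1)}m)$ for all $h,l,m\in H$. Set $\Pi^L(h):=\epsilon(1^{(1)}h)1^{(2)}$ and $\Pi^R(h):=1^{(1)}\epsilon(h1^{(2)})$; these are idempotent maps $H\to H$, and their images $H^L:=\mathrm{Im}(\Pi^L)$ and $H^R:=\mathrm{Im}(\Pi^R)$ are subalgebras of $H$. An antipode is a map $S\colon H\to H$ with $h^{(1)}S(h^{(2)})=\Pi^L(h)$, $S(h^{(1)})h^{(2)}=\Pi^R(h)$ and $S(h^{(1)})h^{(2)}S(h^{(3)})=S(h)$ for all $h$; it is unique if it exists. A weak Hopf algebra is a weak bialgebra with an antipode. The tensor product $H\otimes_{H^R}H$ is formed using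 right and left multiplication by the subalgebra $H^R$, and $\sigma(h,k)$ stands for $\sigma(h\otimes_{H^R}k)$. *)

(* Defs.v *)
From HB Require Import structures.
From mathcomp Require Import all_boot all_algebra.
From mathcomp Require Import boolp classical_sets.
From mathcomp Require Import freeg.

Set Implicit Arguments.
Unset Strict Implicit.
Unset Printing Implicit Defensive.

Import GRing.Theory.
Local Open Scope ring_scope.
Local Open Scope classical_set_scope.
Local Open Scope quotient_scope.

Reserved Notation "v ⊗ w" (at level 40, left associativity).
Reserved Notation "h ⊗R k" (at level 40, left associativity).
Reserved Notation "h ·[ rho ] a" (at level 40, left associativity,
  format "h  ·[ rho ]  a").
Reserved Notation "\sw_ ( h1 , h2 <- h ) E"
  (at level 41, E at level 41, h1 name, h2 name, h at level 50,
   format "'[' \sw_ ( h1 ,  h2  <-  h ) '/  '  E ']'").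

(* Associative unital algebras over a field, the zero algebra included:
   MathComp's algType has in addition 1 != 0. *)
Record kalgType (K : fieldType) := KAlgType {
  kalg_lmod : lmodType K;
  kalg_one : kalg_lmod;
  kalg_mul : kalg_lmod -> kalg_lmod -> kalg_lmod;
  kalg_mulA : associative kalg_mul;
  kalg_mul1l : left_id kalg_one kalg_mul;
  kalg_mul1r : right_id kalg_one kalg_mul;
  kalg_mulDl : left_distributive kalg_mul +%R;
  kalg_mulDr : right_distributive kalg_mul +%R;
  kalg_scaleAl : forall (a : K) x y, a *: kalg_mul x y = kalg_mul (a *: x) y;
  kalg_scaleAr : forall (a : K) x y, a *: kalg_mul x y = kalg_mul x (a *: y)
}.

Definition kalg_sort (K : fieldType) (A : kalgType K) : Type := kalg_lmod A.
Coercion kalg_sort : kalgType >-> Sortclass.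

Section KAlgInstances.
Variables (K : fieldType) (A : kalgType K).

HB.instance Definition _ := GRing.Lmodule.on (kalg_sort A).
HB.instance Definition _ := GRing.Zmodule_isPzRing.Build (kalg_sort A)
  (@kalg_mulA K A) (@kalg_mul1l K A) (@kalg_mul1r K A)
  (@kalg_mulDl K A) (@kalg_mulDr K A).

Lemma kscalerAl (a : K) (x y : A) : a *: (x * y) = a *: x * y.
Proof. exact: kalg_scaleAl. Qed.

Lemma kscalerAr (a : K) (x y : A) : a *: (x * y) = x * (a *: y).
Proof. exact: kalg_scaleAr. Qed.

End KAlgInstances.

Definition kalg_of_algType (K : fieldType) (A : algType K) : kalgType K :=
  KAlgType (@mulrA A) (@mul1r A) (@mulr1 A) (@mulrDl A) (@mulrDr A)
    (@scalerAl K A) (@scalerAr K A).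

Section LinearQuotient.
Variables (K : fieldType) (V : lmodType K) (G : set V).

Definition lspan : {pred V} := fun v =>
  `[< exists2 s : seq (K * V), forall p, p \in s -> G p.2
      & v = \sum_(p <- s) p.1 *: p.2 >].

Lemma lspan_submod_closed : submod_closed lspan.
Proof.
split=> [|a u v /asboolP[s sG ->] /asboolP[t tG ->]].
  by apply/asboolP; exists [::] => //; rewrite big_nil.
apply/asboolP; exists ([seq (a * p.1, p.2) | p <- s] ++ t).
  by move=> p; rewrite mem_cat => /orP[/mapP[q /sG Gq ->]//|/tG].
rewrite big_cat big_map scaler_sumr; congr (_ + _).
by apply: eq_bigr => p _; rewrite scalerA.
Qed.

HB.instance Definition _ := GRing.isSubmodClosed.Build K V lspan
  lspan_submod_closed.

Lemma lspan_oppr_closed : oppr_closed lspan.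
Proof. by move=> v vG; rewrite -scaleN1r rpredZ. Qed.

HB.instance Definition _ := GRing.isOppClosed.Build V lspan lspan_oppr_closed.

Lemma mem_lspan v : G v -> v \in lspan.
Proof.
move=> Gv; apply/asboolP; exists [:: (1, v)]; last by rewrite big_seq1 scale1r.
by move=> p; rewrite inE => /eqP ->.
Qed.

Definition lquot : Type := {ideal_quot lspan}.

HB.instance Definition _ := GRing.Zmodule.on lquot.

Definition lpi (v : V) : lquot := \pi_({ideal_quot lspan}) v.
Definition lrepr (q : lquot) : V := repr (q : {ideal_quot lspan}).

Lemma lreprK : cancel lrepr lpi. Proof. exact: reprK. Qed.

Lemma lpi_eqP u v : reflect (lpi u = lpi v) (u - v \in lspan).
Proof. by rewrite Quotient.idealrBE; exact: eqP. Qed.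

Lemma lpiD : {morph lpi : u v / u + v}.
Proof. by move=> u v; rewrite /lpi [RHS]piE. Qed.

Definition lquot_scale (a : K) (q : lquot) : lquot := lpi (a *: lrepr q).

Lemma lquot_scaleE a v : lquot_scale a (lpi v) = lpi (a *: v).
Proof.
by apply/lpi_eqP; rewrite -scalerBr rpredZ //; apply/lpi_eqP; rewrite lreprK.
Qed.

Lemma lquot_scaleA a b q :
  lquot_scale a (lquot_scale b q) = lquot_scale (a * b) q.
Proof. by rewrite -[q]lreprK !lquot_scaleE scalerA. Qed.

Lemma lquot_scale1 : left_id 1 lquot_scale.
Proof. by move=> q; rewrite -[q]lreprK !lquot_scaleE scale1r. Qed.

Lemma lquot_scaleDr : right_distributive lquot_scale +%R.
Proof.
move=> a p q; rewrite -[p]lreprK -[q]lreprK.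
by rewrite -lpiD !lquot_scaleE scalerDr lpiD.
Qed.

Lemma lquot_scaleDl q : {morph lquot_scale^~ q : a b / a + b}.
Proof. by move=> a b; rewrite -[q]lreprK !lquot_scaleE scalerDl lpiD. Qed.

HB.instance Definition _ := GRing.Zmodule_isLmodule.Build K lquot
  lquot_scaleA lquot_scale1 lquot_scaleDr lquot_scaleDl.

Lemma lpi_linear : linear lpi.
Proof. by move=> a u v; rewrite lpiD -lquot_scaleE. Qed.

HB.instance Definition _ := GRing.isLinear.Build K V lquot _ lpi lpi_linear.

End LinearQuotient.

Section Tensor.
Variables (K : fieldType) (V W : lmodType K).

Local Notation free := {freeg (V * W)%type / K}.
Local Notation "<[ v , w ]>" := (Freeg [:: (1, (v, w))] : free).

Definition tens_rel : set free := [set t |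
  [\/ exists v v' w, t = <[v + v', w]> - <[v, w]> - <[v', w]>,
      exists v w w', t = <[v, w + w']> - <[v, w]> - <[v, w']>,
      exists a v w, t = <[a *: v, w]> - a *: <[v, w]>
    | exists a v w, t = <[v, a *: w]> - a *: <[v, w]> ]].

Definition tens : Type := lquot tens_rel.

HB.instance Definition _ := GRing.Lmodule.on tens.

Definition tmk (v : V) (w : W) : tens := lpi tens_rel <[v, w]>.

(* The linear map v ⊗ w |-> f v w, see tliftE and tlift_linear below; this is
   meaningful only when f is bilinear, otherwise it depends on lrepr. *)
Definition tlift (U : lmodType K) (f : V -> W -> U) (t : tens) : U :=
  fglift (fun p : V * W => f p.1 p.2) (lrepr t).

End Tensor.

Notation "V ⊗ W" := (tens V W) : type_scope.
Notation "v ⊗ w" := (tmk v w) : ring_scope.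

Section TensorTheory.
Variables (K : fieldType) (V W : lmodType K).

Lemma tmkDl (v v' : V) (w : W) : (v + v') ⊗ w = v ⊗ w + v' ⊗ w.
Proof.
rewrite /tmk -lpiD; apply/lpi_eqP; rewrite opprD addrA.
by apply/mem_lspan/Or41; exists v, v', w.
Qed.

Lemma tmkDr (v : V) (w w' : W) : v ⊗ (w + w') = v ⊗ w + v ⊗ w'.
Proof.
rewrite /tmk -lpiD; apply/lpi_eqP; rewrite opprD addrA.
by apply/mem_lspan/Or42; exists v, w, w'.
Qed.

Lemma tmkZl (a : K) (v : V) (w : W) : (a *: v) ⊗ w = a *: (v ⊗ w).
Proof.
rewrite /tmk -linearZ; apply/lpi_eqP.
by apply/mem_lspan/Or43; exists a, v, w.
Qed.

Lemma tmkZr (a : K) (v : V) (w : W) : v ⊗ (a *: w) = a *: (v ⊗ w).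
Proof.
rewrite /tmk -linearZ; apply/lpi_eqP.
by apply/mem_lspan/Or44; exists a, v, w.
Qed.

Section Lift.
Variables (U : lmodType K) (f : V -> W -> U).
Hypotheses (f_linl : forall w, linear (f^~ w)) (f_linr : forall v, linear (f v)).

Let F (p : V * W) := f p.1 p.2.
Local Notation free := {freeg (V * W)%type / K}.

Let fglift_linear : linear (fglift F : free -> U).
Proof.
have FB : {morph (fglift F : free -> U) : x y / x - y}.
  exact: lift_is_additive.
have F0 : fglift F (0 : free) = 0 by rewrite -(subrr 0) FB subrr.
have FN : {morph (fglift F : free -> U) : x / - x}.
  by move=> x; rewrite -[- x]add0r FB F0 add0r.
have FD : {morph (fglift F : free -> U) : x y / x + y}.
  by move=> x y; rewrite -[y in LHS]opprK FB FN opprK.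
move=> a x y; rewrite FD; congr (_ + _).
rewrite -{2}[x]freeg_sumE.
pose L : {additive free -> U} := HB.pack_for {additive free -> U} (fglift F : free -> U)
  (GRing.isZmodMorphism.Build _ _ (fglift F : free -> U) FB).
have LE z : fglift F z = L z by [].
rewrite [a *: x]/(fgscale a x) /fgscale !LE !raddf_sum.
by apply: eq_bigr => z _; rewrite -!LE !liftU [RHS]scalerA.
Qed.

Lemma tlift_lpi (x : free) : tlift f (lpi (@tens_rel K V W) x) = fglift F x.
Proof.
have FB : {morph (fglift F : free -> U) : x y / x - y}.
  exact: lift_is_additive.
pose L : {linear free -> U} := HB.pack_for {linear free -> U} (fglift F : free -> U)
  (GRing.isLinear.Build _ _ _ _ (fglift F : free -> U) fglift_linear).
have LE z : fglift F z = L z by [].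
apply/eqP; rewrite -subr_eq0 /tlift !LE -linearB; apply/eqP.
set d := _ - _; have : d \in lspan (@tens_rel K V W).
  by apply/lpi_eqP; rewrite lreprK.
have f0l w : f 0 w = 0.
  by have := f_linl w (-1) 0 0; rewrite scaler0 addr0 scaleN1r addNr.
have f0r v : f v 0 = 0.
  by have := f_linr v (-1) 0 0; rewrite scaler0 addr0 scaleN1r addNr.
have FZ c y : fglift F (c *: y) = c *: fglift F y by rewrite !LE linearZ.
have L0 q : tens_rel q -> fglift F q = 0.
  move=> [] => [[v [v' [w ->]]]|[v [w [w' ->]]]|[c [v [w ->]]]|[c [v [w ->]]]].
  - rewrite !FB !liftU !scale1r /F /= -[v in f (v + v')]scale1r f_linl.
    by rewrite scale1r -addrA -opprD subrr.
  - rewrite !FB !liftU !scale1r /F /= -[w in f _ (w + w')]scale1r f_linr.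
    by rewrite scale1r -addrA -opprD subrr.
  - rewrite FB FZ !liftU !scale1r /F /= -[c *: v]addr0 f_linl f0l addr0.
    by rewrite subrr.
  - rewrite FB FZ !liftU !scale1r /F /= -[c *: w]addr0 f_linr f0r addr0.
    by rewrite subrr.
move=> /asboolP[s sG ->]; rewrite linear_sum big_seq big1 // => p /sG /L0.
by rewrite linearZ LE => ->; exact: scaler0.
Qed.

Lemma tliftE (v : V) (w : W) : tlift f (v ⊗ w) = f v w.
Proof. by rewrite tlift_lpi liftU scale1r. Qed.

Lemma tlift_linear : linear (tlift f).
Proof.
move=> a s t; rewrite -[s]lreprK -[t]lreprK -linearP.
by rewrite !tlift_lpi fglift_linear.
Qed.

End Lift.
End TensorTheory.

Definition sweedler (K : fieldType) (H U : lmodType K) (D : H -> H ⊗ H)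
  (h : H) (f : H -> H -> U) : U := tlift f (D h).

Section WeakBialgebraAxioms.
Variables (K : fieldType) (H : kalgType K).
Variables (D : {linear H -> (H ⊗ H)%type}) (e : {scalar H}).

Local Notation "\sw_ ( h1 , h2 <- h ) E" :=
  (sweedler D h (fun h1 h2 => E)) : ring_scope.

(* Coassociativity is stated in (H ⊗ H) ⊗ H, along the associator. *)
Record coalgebra_axioms : Prop := {
  coassoc_ax : forall h : H,
    \sw_(h1, h2 <- h) \sw_(h11, h12 <- h1) h11 ⊗ h12 ⊗ h2 =
    \sw_(h1, h2 <- h) \sw_(h21, h22 <- h2) h1 ⊗ h21 ⊗ h22;
  counitl_ax : forall h : H, \sw_(h1, h2 <- h) (e h1 *: h2) = h;
  counitr_ax : forall h : H, \sw_(h1, h2 <- h) (e h2 *: h1) = h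
}.

Record weak_bialgebra_axioms : Prop := {
  comultM_ax : forall h l : H,
    D (h * l) = \sw_(h1, h2 <- h) \sw_(l1, l2 <- l) (h1 * l1) ⊗ (h2 * l2);
  comult1l_ax :
    \sw_(u1, u2 <- 1) D u1 ⊗ u2 =
    \sw_(u1, u2 <- 1) \sw_(v1, v2 <- 1) u1 ⊗ (u2 * v1) ⊗ v2;
  comult1r_ax :
    \sw_(u1, u2 <- 1) D u1 ⊗ u2 =
    \sw_(u1, u2 <- 1) \sw_(v1, v2 <- 1) u1 ⊗ (v1 * u2) ⊗ v2;
  counitMl_ax : forall h l m : H,
    e (h * l * m) = \sw_(l1, l2 <- l) (e (h * l1) * e (l2 * m) : K^o);
  counitMr_ax : forall h l m : H,
    e (h * l * m) = \sw_(l1, l2 <- l) (e (h * l2) * e (l1 * m) : K^o)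
}.

End WeakBialgebraAxioms.

Record weakBialgType (K : fieldType) := WeakBialgType {
  wb_alg :> kalgType K;
  comult : {linear wb_alg -> (wb_alg ⊗ wb_alg)%type};
  counit : {scalar wb_alg};
  wb_coalgP : coalgebra_axioms comult counit;
  wbP : weak_bialgebra_axioms comult counit
}.

Definition wb_sweedler (K : fieldType) (H : weakBialgType K) (U : lmodType K)
  (h : H) (f : H -> H -> U) : U := sweedler (comult H) h f.

(* Sweedler notation: E is to be bilinear in h1 = h^(1) and h2 = h^(2). *)
Notation "\sw_ ( h1 , h2 <- h ) E" :=
  (wb_sweedler h (fun h1 h2 => E)) : ring_scope.

Section WeakBialgebra.
Variables (K : fieldType) (H : weakBialgType K).

Definition PiL (h : H) : H := \sw_(u1, u2 <- 1) (counit H (u1 * h) *: u2).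
Definition PiR (h : H) : H := \sw_(u1, u2 <- 1) (counit H (h * u2) *: u1).

Definition HL : set H := range PiL.
Definition HR : set H := range PiR.

(* H ⊗_{H^R} H as a quotient of H ⊗ H *)
Definition HR_rel : set (H ⊗ H) := [set t |
  exists h r k, HR r /\ t = (h * r) ⊗ k - h ⊗ (r * k)].

Definition tensHR : Type := lquot HR_rel.

HB.instance Definition _ := GRing.Lmodule.on tensHR.

Definition projHR : H ⊗ H -> tensHR := lpi HR_rel.

HB.instance Definition _ := GRing.Linear.on projHR.

Definition tmkHR (h k : H) : tensHR := projHR (h ⊗ k).

Lemma tmkHR_balanced (h r k : H) : HR r -> tmkHR (h * r) k = tmkHR h (r * k).
Proof. by move=> HRr; apply/lpi_eqP/mem_lspan; exists h, r, k. Qed.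

Record antipode_axioms (S : {linear H -> H}) : Prop := {
  antipodeL_ax : forall h : H, \sw_(h1, h2 <- h) h1 * S h2 = PiL h;
  antipodeR_ax : forall h : H, \sw_(h1, h2 <- h) S h1 * h2 = PiR h;
  antipodeS_ax : forall h : H,
    \sw_(h', h3 <- h) \sw_(h1, h2 <- h') S h1 * h2 * S h3 = S h
}.

End WeakBialgebra.

Notation "h ⊗R k" := (tmkHR h k) : ring_scope.

Record weakHopfType (K : fieldType) := WeakHopfType {
  wh_bialg :> weakBialgType K;
  antipode : {linear wh_bialg -> wh_bialg};
  antipodeP : antipode_axioms antipode
}.

Definition kact (K : fieldType) (H A : kalgType K)
  (rho : {linear (H ⊗ A)%type -> A}) (h : H) (a : A) : A := rho (h ⊗ a).

Notation "h ·[ rho ] a" := (kact rho h a) : ring_scope.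

(* Main.v *)
Require Import Defs.
From HB Require Import structures.
From mathcomp Require Import all_boot all_algebra.
From mathcomp Require Import boolp classical_sets.
From mathcomp Require freeg.

(* A factor k is recovered as Pi^L(k1) k2, and by (1) acting on 1_A only sees
   Pi^L; with (6) this gives
   (h1 . (k1 . 1)) sigma(h2, k2) = sigma(h, Pi^L(k1) k2) = sigma(h, k), which
   yields (19) (through (9)) and (20), and with (5) similarly (21).  For (22),
   the first leg of Delta(1) lies in H^R; for r in H^R, Delta(r) = 1_1 ⊗ 1_2 r,
   so S(r) = Pi^R(r1) S(r2) = r1 S(r2) = Pi^L(r).  Hence r = S^-1(Pi^L(r)), and
   (3) at h = 1 reads r . a = a (Pi^L(r) . 1) = a (r . 1). *)

Set Implicit Arguments.
Unset Strict Implicit.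
Unset Printing Implicit Defensive.

Import GRing.Theory.
Local Open Scope ring_scope.

(** The two conjuncts are exactly the hypotheses of [tliftE] and [tlift_linear], under which a
    Sweedler sum is meaningful. *)
Definition bilinear_map (K : fieldType) (U V W : lmodType K)
  (f : U -> V -> W) : Prop :=
  (forall v, linear (f^~ v)) /\ (forall u, linear (f u)).

(** * Closure properties of linear maps *)

Section LinearClosure.
Variables (K : fieldType) (X : lmodType K).

Lemma linear_idfun : linear (fun x : X => x).
Proof. by []. Qed.

Lemma linear_postcomp (U V : lmodType K) (L : {linear U -> V}) (f : X -> U) :
  linear f -> linear (fun x => L (f x)).
Proof. by move=> fL c x y; rewrite fL linearP. Qed.

Lemma linear_mull (B : kalgType K) (f : X -> B) (b : B) :
  linear f -> linear (fun x => f x * b).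
Proof. by move=> fL c x y; rewrite fL mulrDl kscalerAl. Qed.

Lemma linear_mulr (B : kalgType K) (f : X -> B) (b : B) :
  linear f -> linear (fun x => b * f x).
Proof. by move=> fL c x y; rewrite fL mulrDr kscalerAr. Qed.

Lemma linear_tmkl (U V : lmodType K) (f : X -> U) (v : V) :
  linear f -> linear (fun x => f x ⊗ v).
Proof. by move=> fL c x y; rewrite fL tmkDl tmkZl. Qed.

Lemma linear_tmkr (U V : lmodType K) (f : X -> V) (u : U) :
  linear f -> linear (fun x => u ⊗ f x).
Proof. by move=> fL c x y; rewrite fL tmkDr tmkZr. Qed.

Lemma linear_scalel (U : lmodType K) (B : lmodType K) (e : {scalar B})
    (f : X -> B) (u : U) : linear f -> linear (fun x => e (f x) *: u).
Proof. by move=> fL c x y; rewrite fL linearP scalerDl scalerA. Qed.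

Lemma linear_scaler (U : lmodType K) (a : K) (f : X -> U) :
  linear f -> linear (fun x => a *: f x).
Proof.
by move=> fL c x y; rewrite fL scalerDr !scalerA mulrC.
Qed.

Lemma linear_map_sum (U : lmodType K) (L : X -> U) (I : Type) (s : seq I)
    (F : I -> X) : linear L -> L (\sum_(i <- s) F i) = \sum_(i <- s) L (F i).
Proof.
move=> LL; have L0 : L 0 = 0.
  by have := LL (-1) 0 0; rewrite scaler0 addr0 scaleN1r addNr.
elim: s => [|i s IH]; first by rewrite !big_nil.
by rewrite !big_cons -IH -[F i in LHS]scale1r LL scale1r.
Qed.

Lemma linear_map_scale (U : lmodType K) (L : X -> U) (c : K) (x : X) :
  linear L -> L (c *: x) = c *: L x.
Proof.
(* The empty sum yields [L 0 = 0]. *)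
move=> LL; have := linear_map_sum [::] (fun _ : void => 0) LL.
by rewrite !big_nil => L0; rewrite -[c *: x]addr0 LL L0 addr0.
Qed.

End LinearClosure.

(** * Tensors as finite sums of pure tensors *)

Section TensorSums.
Variables (K : fieldType) (V W : lmodType K).

(** A representative in the free module is a finite combination of generators, whose coefficients
    are absorbed into the left legs. *)
Lemma tens_sumP (t : (V ⊗ W)%type) :
  exists s : seq (V * W), t = \sum_(p <- s) p.1 ⊗ p.2.
Proof.
rewrite -[t]lreprK -[lrepr t]freeg.freeg_sumE linear_sum.
exists [seq (freeg.coeff p (lrepr t) *: p.1, p.2) | p <- freeg.dom (lrepr t)].
rewrite [RHS]big_map; apply: eq_bigr => -[v w] _ /=.
rewrite tmkZl /tmk -linearZ; congr lpi.
apply/eqP/freeg.freeg_eqP => z; rewrite freeg.coeff_fgscale !freeg.coeffU.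
by rewrite mul1r.
Qed.

Lemma linear_tlift (U U' : lmodType K) (L : U -> U') (f : V -> W -> U)
    (t : (V ⊗ W)%type) : linear L -> bilinear_map f ->
  L (tlift f t) = tlift (fun v w => L (f v w)) t.
Proof.
move=> LL [fl fr].
have Lfl w : linear (fun v => L (f v w)) by move=> c x y; rewrite fl LL.
have Lfr v : linear (fun w => L (f v w)) by move=> c x y; rewrite fr LL.
have [s ->] := tens_sumP t.
rewrite (linear_map_sum _ _ (tlift_linear fl fr)).
rewrite (linear_map_sum _ _ (tlift_linear Lfl Lfr)) (linear_map_sum _ _ LL).
by apply: eq_bigr => p _; rewrite (tliftE fl fr) (tliftE Lfl Lfr).
Qed.

End TensorSums.

(** * Calculus of Sweedler sums *)

Section SweedlerCalculus.
Variables (K : fieldType) (H : weakBialgType K).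

Lemma eq_sw (U : lmodType K) (h : H) (f g : H -> H -> U) :
  (forall a b, f a b = g a b) -> \sw_(a, b <- h) f a b = \sw_(a, b <- h) g a b.
Proof. by move=> fg; congr wb_sweedler; apply/funext => a; apply/funext. Qed.

Lemma sw_linear (U U' : lmodType K) (L : U -> U') (f : H -> H -> U) (h : H) :
  linear L -> bilinear_map f ->
  L (\sw_(a, b <- h) f a b) = \sw_(a, b <- h) L (f a b).
Proof. exact: linear_tlift. Qed.

Lemma linear_sw (X U : lmodType K) (h : H) (E : X -> H -> H -> U) :
  (forall x, bilinear_map (E x)) -> (forall a b, linear (fun x => E x a b)) ->
  linear (fun x => \sw_(a, b <- h) E x a b).
Proof.
move=> bE lE c x y; rewrite /wb_sweedler /sweedler.
have [s ->] := tens_sumP (comult H h).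
rewrite !(linear_map_sum _ _ (tlift_linear (bE _).1 (bE _).2)) scaler_sumr.
rewrite -big_split; apply: eq_bigr => p _ /=.
by rewrite !(tliftE (bE _).1 (bE _).2) lE.
Qed.

Lemma linear_sw_arg (X U : lmodType K) (g : X -> H) (f : H -> H -> U) :
  bilinear_map f -> linear g -> linear (fun x => \sw_(a, b <- g x) f a b).
Proof.
move=> [fl fr] lg c x y; rewrite /wb_sweedler /sweedler lg linearP.
exact: (tlift_linear fl fr).
Qed.

(** Decomposing both coproducts into finite sums of pure tensors reduces this to [exchange_big];
    bilinearity in each pair of legs is what permits the two expansions. *)
Lemma exchange_sw (U : lmodType K) (h k : H) (f : H -> H -> H -> H -> U) :
  (forall c d, bilinear_map (fun a b => f a b c d)) ->
  (forall a b, bilinear_map (f a b)) ->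
  \sw_(a, b <- h) \sw_(c, d <- k) f a b c d =
  \sw_(c, d <- k) \sw_(a, b <- h) f a b c d.
Proof.
move=> f12 f34; rewrite [RHS]/wb_sweedler /sweedler.
have [s Es] := tens_sumP (comult H k).
have swE (g : H -> H -> U) : bilinear_map g ->
    \sw_(c, d <- k) g c d = \sum_(p <- s) g p.1 p.2.
  move=> [gl gr]; rewrite /wb_sweedler /sweedler Es.
  rewrite (linear_map_sum _ _ (tlift_linear gl gr)).
  by apply: eq_bigr => p _; rewrite (tliftE gl gr).
rewrite [RHS]swE; last first.
  split=> [d|c].
    apply: linear_sw => [c|a b]; first exact: f12.
    exact: (f34 a b).1.
  apply: linear_sw => [d|a b]; first exact: f12.
  exact: (f34 a b).2.
rewrite (eq_sw _ (fun a b => swE _ (f34 a b))).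
rewrite /wb_sweedler /sweedler; have [t ->] := tens_sumP (comult H h).
have sl (b : H) : linear (fun a => \sum_(p <- s) f a b p.1 p.2).
  move=> c x y; rewrite scaler_sumr -big_split; apply: eq_bigr => p _ /=.
  exact: (f12 p.1 p.2).1.
have sr (a : H) : linear (fun b => \sum_(p <- s) f a b p.1 p.2).
  move=> c x y; rewrite scaler_sumr -big_split; apply: eq_bigr => p _ /=.
  exact: (f12 p.1 p.2).2.
rewrite (linear_map_sum _ _ (tlift_linear sl sr)).
rewrite (eq_bigr _ (fun q _ => tliftE sl sr q.1 q.2)) exchange_big.
apply: eq_bigr => p _.
have [fl fr] := f12 p.1 p.2.
rewrite (linear_map_sum _ _ (tlift_linear fl fr)).
by apply: eq_bigr => q _; rewrite (tliftE fl fr).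
Qed.

End SweedlerCalculus.

Section MoreLinearClosure.
Variables (K : fieldType) (X : lmodType K).

Lemma linear_kactl (B A : kalgType K) (rho : {linear (B ⊗ A)%type -> A})
    (f : X -> B) (a : A) : linear f -> linear (fun x => f x ·[rho] a).
Proof. by move=> fL; apply/linear_postcomp/linear_tmkl. Qed.

Lemma linear_kactr (B A : kalgType K) (rho : {linear (B ⊗ A)%type -> A})
    (h : B) (f : X -> A) : linear f -> linear (fun x => h ·[rho] f x).
Proof. by move=> fL; apply/linear_postcomp/linear_tmkr. Qed.

Lemma linear_tmkHRl (H : weakBialgType K) (f : X -> H) (k : H) :
  linear f -> linear (fun x => f x ⊗R k).
Proof. by move=> fL; apply/linear_postcomp/linear_tmkl. Qed.

Lemma linear_tmkHRr (H : weakBialgType K) (h : H) (f : X -> H) :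
  linear f -> linear (fun x => h ⊗R f x).
Proof. by move=> fL; apply/linear_postcomp/linear_tmkr. Qed.

End MoreLinearClosure.

(** The rules follow the outermost operation; the general [linear_postcomp], for an arbitrary
    bundled linear map, is tried last. *)
Ltac multilinear :=
  cbv beta;
  lazymatch goal with
  | |- forall _, _ => let x := fresh in intro x; multilinear
  | |- bilinear_map _ => split; multilinear
  | _ => first
    [ exact: linear_idfun
    | apply: linear_mull; multilinear | apply: linear_mulr; multilinear
    | apply: linear_tmkl; multilinear | apply: linear_tmkr; multilinear
    | apply: linear_scalel; multilinear | apply: linear_scaler; multilinear
    | apply: linear_kactl; multilinear | apply: linear_kactr; multilinear
    | apply: linear_tmkHRl; multilinear | apply: linear_tmkHRr; multilinear
    | apply: linear_sw; multilinear | apply: linear_sw_arg; multilinear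
    | apply: linear_postcomp; multilinear ]
  end.

(** * Identities in a weak bialgebra *)

Section WeakBialgebraTheory.
Variables (K : fieldType) (H : weakBialgType K).
Implicit Types h k : H.

Local Notation e := (counit H).

Lemma linear_PiL : linear (@PiL K H).
Proof. rewrite /PiL; multilinear. Qed.

HB.instance Definition _ :=
  GRing.isLinear.Build K H H _ (@PiL K H) linear_PiL.

Lemma linear_PiR : linear (@PiR K H).
Proof. rewrite /PiR; multilinear. Qed.

HB.instance Definition _ :=
  GRing.isLinear.Build K H H _ (@PiR K H) linear_PiR.

Lemma counit_mulr2 h l k :
  e (h * l * k) = \sw_(a, b <- l) (e (h * b) * e (a * k) : K^o).
Proof. exact: counitMr_ax (wbP H) h l k. Qed.

Lemma comultM h k :
  comult H (h * k) = \sw_(a, b <- h) \sw_(c, d <- k) (a * c) ⊗ (b * d).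
Proof. exact: comultM_ax (wbP H) h k. Qed.

Lemma comult1_left : \sw_(a, b <- 1) comult H a ⊗ b =
  \sw_(a, b <- 1) \sw_(c, d <- 1) a ⊗ (b * c) ⊗ d.
Proof. exact: comult1l_ax (wbP H). Qed.

Lemma comult1_right : \sw_(a, b <- 1) comult H a ⊗ b =
  \sw_(a, b <- 1) \sw_(c, d <- 1) a ⊗ (c * b) ⊗ d.
Proof. exact: comult1r_ax (wbP H). Qed.

Lemma sw_counitl h : \sw_(a, b <- h) (e a *: b) = h.
Proof. exact: counitl_ax (wb_coalgP H) h. Qed.

Lemma sw_counitr h : \sw_(a, b <- h) (e b *: a) = h.
Proof. exact: counitr_ax (wb_coalgP H) h. Qed.

(** Weak multiplicativity of the counit on h 1 k gives e(h 1_2) e(1_1 k), which is e(h Pi^L(k)) by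
    linearity. *)
Lemma counit_mul_PiL h k : e (h * PiL k) = e (h * k).
Proof.
rewrite -[in RHS](mulr1 h) counit_mulr2 /PiL.
rewrite (sw_linear (L := fun x : H => e (h * x) : K^o)); try multilinear.
by apply: (eq_sw (U := K^o)) => a b; rewrite -kscalerAr linearZ mulrC.
Qed.

Lemma PiL_mul_PiL h k : PiL (h * PiL k) = PiL (h * k).
Proof. by apply: eq_sw => a b; rewrite !mulrA counit_mul_PiL. Qed.

Lemma sw_mul (U : lmodType K) (f : H -> H -> U) h k : bilinear_map f ->
  \sw_(a, b <- h * k) f a b =
  \sw_(a, b <- h) \sw_(c, d <- k) f (a * c) (b * d).
Proof.
move=> bf; have [fl fr] := bf.
rewrite {1}/wb_sweedler /sweedler comultM.
rewrite (sw_linear _ (tlift_linear fl fr)); last by multilinear.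
apply: eq_sw => a b; rewrite (sw_linear _ (tlift_linear fl fr)).
  by apply: eq_sw => c d; rewrite (tliftE fl fr).
by multilinear.
Qed.

Section ComultOfUnit.
Variables (U : lmodType K) (G : H -> H -> H -> U).
Hypotheses (Gl : forall z, bilinear_map (fun x y => G x y z)).
Hypotheses (Gr : forall x y, linear (G x y)).

(** [tlift T] is then the linear map on (H ⊗ H) ⊗ H induced by the trilinear [G]; applying it to the
    axioms for Delta^2(1) gives the two lemmas below. *)
Let T (t : (H ⊗ H)%type) (z : H) : U := tlift (fun x y => G x y z) t.

Let Tl z : linear (T^~ z).
Proof. exact: tlift_linear (Gl z).1 (Gl z).2. Qed.

Let Tr t : linear (T t).
Proof.
move=> c x y; have [s ->] := tens_sumP t.
rewrite !(linear_map_sum _ _ (Tl _)) scaler_sumr -big_split.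
apply: eq_bigr => p _ /=.
by rewrite /T !(tliftE (Gl _).1 (Gl _).2) Gr.
Qed.

Let Tlin : linear (tlift T). Proof. exact: tlift_linear. Qed.

Let TE x y z : tlift T (x ⊗ y ⊗ z) = G x y z.
Proof. by rewrite (tliftE Tl Tr) /T (tliftE (Gl z).1 (Gl z).2). Qed.

Let T_comult : tlift T (\sw_(a, b <- 1) comult H a ⊗ b) =
  \sw_(a, b <- 1) \sw_(c, d <- a) G c d b.
Proof.
rewrite (sw_linear _ Tlin); last by multilinear.
by apply: eq_sw => a b; rewrite (tliftE Tl Tr).
Qed.

Lemma sw1_comult_left : \sw_(a, b <- 1) \sw_(c, d <- a) G c d b =
  \sw_(a, b <- 1) \sw_(c, d <- 1) G a (b * c) d.
Proof.
rewrite -T_comult comult1_left (sw_linear _ Tlin); last by multilinear.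
apply: eq_sw => a b; rewrite (sw_linear _ Tlin); last by multilinear.
by apply: eq_sw => c d; rewrite TE.
Qed.

Lemma sw1_comult_right : \sw_(a, b <- 1) \sw_(c, d <- a) G c d b =
  \sw_(a, b <- 1) \sw_(c, d <- 1) G a (c * b) d.
Proof.
rewrite -T_comult comult1_right (sw_linear _ Tlin); last by multilinear.
apply: eq_sw => a b; rewrite (sw_linear _ Tlin); last by multilinear.
by apply: eq_sw => c d; rewrite TE.
Qed.

End ComultOfUnit.

(** Apply the counit identity to h = 1 h: it reads e(1_1 h1) 1_2 h2 = h, and e(1_1 h1) 1_2 is
    Pi^L(h1). *)
Lemma sw_PiL_mul h : \sw_(a, b <- h) PiL a * b = h.
Proof.
rewrite -[RHS]sw_counitl -[in RHS](mul1r h) sw_mul; last by multilinear.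
rewrite exchange_sw; [|multilinear..].
apply: eq_sw => a b.
rewrite /PiL (sw_linear (L := fun x : H => x * b)); [|multilinear..].
by apply: eq_sw => u v; rewrite kscalerAl.
Qed.

(** The first leg of Delta(1) lies in H^R: applying e to the middle leg of Delta^2(1) = 1_1 ⊗ 1'_1
    1_2 ⊗ 1'_2 gives Delta(1) on one side and 1_1 e(1'_1 1_2) ⊗ 1'_2 = Pi^R(1'_1) ⊗ 1'_2 on the
    other. *)
Lemma sw1_PiR (U : lmodType K) (f : H -> H -> U) : bilinear_map f ->
  \sw_(a, b <- 1) f (PiR a) b = \sw_(a, b <- 1) f a b.
Proof.
move=> bf; have [fl fr] := bf.
pose G (x y z : H) : U := e y *: f x z.
have Gl z : bilinear_map (fun x y => G x y z).
  split=> [y|x]; rewrite /G; last by multilinear.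
  by apply: linear_scaler; apply: fl.
have Gr x y : linear (G x y) by apply: linear_scaler; apply: fr.
transitivity (\sw_(a, b <- 1) \sw_(c, d <- a) G c d b); last first.
  apply: eq_sw => a b; rewrite -[in RHS](sw_counitr a).
  rewrite (sw_linear (L := f^~ b)) //; last by multilinear.
  by apply: eq_sw => c d; rewrite /G (linear_map_scale _ _ (fl b)).
rewrite (sw1_comult_right Gl Gr) exchange_sw; last 2 first.
- move=> c d; split=> [b|a]; rewrite /G.
    by apply: linear_scaler; apply: fl.
  by multilinear.
- move=> a b; split=> [d|c]; rewrite /G; first by multilinear.
  by apply: linear_scaler; apply: fr.
apply: eq_sw => a b.
rewrite /PiR (sw_linear (L := f^~ b)) //; last by multilinear.
by apply: eq_sw => c d; rewrite /G (linear_map_scale _ _ (fl b)).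
Qed.

(** Since Pi^R(h) = 1_1 e(h 1_2), its coproduct is Delta^2(1) with e(h -) applied to the last leg.
    In the form 1_1 ⊗ 1_2 1'_1 ⊗ 1'_2 this leaves 1_1 ⊗ 1_2 Pi^R(h). *)
Lemma sw_of_PiR (U : lmodType K) (f : H -> H -> U) h : bilinear_map f ->
  \sw_(a, b <- PiR h) f a b = \sw_(a, b <- 1) f a (b * PiR h).
Proof.
move=> bf; have [fl fr] := bf.
have sl : linear (fun x : H => \sw_(a, b <- x) f a b).
  by apply: linear_sw_arg.
rewrite {1}/PiR (sw_linear _ sl); last by multilinear.
pose G (x y z : H) : U := e (h * z) *: f x y.
have Gl z : bilinear_map (fun x y => G x y z).
  by split=> ?; apply: linear_scaler; [apply: fl | apply: fr].
have Gr x y : linear (G x y) by rewrite /G; multilinear.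
transitivity (\sw_(a, b <- 1) \sw_(c, d <- a) G c d b).
  apply: eq_sw => a b; rewrite (linear_map_scale _ _ sl).
  by rewrite (sw_linear _ (linear_scaler _ (@linear_idfun _ _)) bf).
rewrite (sw1_comult_left Gl Gr); apply: eq_sw => a b.
have fbl : linear (fun x => f a (b * x)).
  by move=> c x y; rewrite mulrDr -kscalerAr fr.
rewrite /PiR (sw_linear _ fbl); last by multilinear.
by apply: eq_sw => c d; rewrite (linear_map_scale _ _ fbl).
Qed.

End WeakBialgebraTheory.

(** * The antipode on H^R *)

Lemma antipode_PiR (K : fieldType) (H : weakHopfType K) (h : H) :
  antipode H (PiR h) = PiL (PiR h).
Proof.
have SP := antipodeP H.
rewrite -(antipodeS_ax SP) -(antipodeL_ax SP) -!/(wb_sweedler _ _).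
(* In S(r1) r2 S(r3) the first two factors collapse to Pi^R of the first leg. *)
transitivity (\sw_(a, b <- PiR h) PiR a * antipode H b).
  apply: eq_sw => a b; rewrite -(antipodeR_ax SP).
  rewrite (sw_linear (L := fun x : H => x * antipode H b)) //; multilinear.
rewrite !sw_of_PiR; [|multilinear..].
by apply: (sw1_PiR (f := fun x y : H => x * antipode H (y * PiR h))); multilinear.
Qed.

Theorem theorem2p1 (K : fieldType) (A : kalgType K) (H : weakHopfType K)
  (Sinv : H -> H)
  (SK : cancel (antipode H) Sinv) (SinvK : cancel Sinv (antipode H))
  (rho : {linear (H ⊗ A)%type -> A})
  (sigma : {linear (tensHR H) -> A})
  (H1 : forall h : H, h ·[rho] 1 = PiL h ·[rho] 1)
  (H2 : forall (h : H) (a a' : A),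
    h ·[rho] (a * a') = \sw_(h1, h2 <- h) (h1 ·[rho] a) * (h2 ·[rho] a'))
  (H3 : forall (h l : H) (a : A), HL l ->
    (Sinv l * h) ·[rho] a = (h ·[rho] a) * (l ·[rho] 1) /\
    (l * h) ·[rho] a = (l ·[rho] 1) * (h ·[rho] a))
  (H4 : forall a : A, 1 ·[rho] a = a)
  (H5 : forall h k l : H, HL l ->
    sigma ((l * h) ⊗R k) = (l ·[rho] 1) * sigma (h ⊗R k) /\
    sigma ((Sinv l * h) ⊗R k) = sigma (h ⊗R k) * (l ·[rho] 1))
  (H6 : forall h k l : H, HL l ->
    \sw_(h1, h2 <- h) (h1 ·[rho] (l ·[rho] 1)) * sigma (h2 ⊗R k) =
    sigma (h ⊗R (l * k)))
  (H7 : forall h : H,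
    sigma (1 ⊗R h) = h ·[rho] 1 /\ sigma (h ⊗R 1) = h ·[rho] 1)
  (H8 : forall h k m : H,
    \sw_(h1, h2 <- h) \sw_(k1, k2 <- k) \sw_(m1, m2 <- m)
      (h1 ·[rho] sigma (k1 ⊗R m1)) * sigma (h2 ⊗R (k2 * m2)) =
    \sw_(h1, h2 <- h) \sw_(k1, k2 <- k)
      sigma (h1 ⊗R k1) * sigma ((h2 * k2) ⊗R m))
  (H9 : forall (h k : H) (a : A),
    \sw_(h1, h2 <- h) \sw_(k1, k2 <- k)
      (h1 ·[rho] (k1 ·[rho] a)) * sigma (h2 ⊗R k2) =
    \sw_(h1, h2 <- h) \sw_(k1, k2 <- k)
      sigma (h1 ⊗R k1) * ((h2 * k2) ·[rho] a))
  (H10 : forall h l : H, HL l ->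
    h ·[rho] (l ·[rho] 1) = (h * l) ·[rho] 1) :
  let varsigma : H ⊗ H -> A := sigma \o @projHR K H in
  (* (2) *)
  (forall (h : H) (a a' : A),
    h ·[rho] (a * a') = \sw_(h1, h2 <- h) (h1 ·[rho] a) * (h2 ·[rho] a')) /\
  (* (4) *)
  (forall a : A, 1 ·[rho] a = a) /\
  (* (11) *)
  (forall h k : H, h ·[rho] (k ·[rho] 1) = (h * k) ·[rho] 1) /\
  (* (17) *)
  (forall h k m : H,
    \sw_(h1, h2 <- h) \sw_(k1, k2 <- k) \sw_(m1, m2 <- m)
      (h1 ·[rho] varsigma (k1 ⊗ m1)) * varsigma (h2 ⊗ (k2 * m2)) =
    \sw_(h1, h2 <- h) \sw_(k1, k2 <- k)
      varsigma (h1 ⊗ k1) * varsigma ((h2 * k2) ⊗ m)) /\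
  (* (18) *)
  (forall (h k : H) (a : A),
    \sw_(h1, h2 <- h) \sw_(k1, k2 <- k)
      (h1 ·[rho] (k1 ·[rho] a)) * varsigma (h2 ⊗ k2) =
    \sw_(h1, h2 <- h) \sw_(k1, k2 <- k)
      varsigma (h1 ⊗ k1) * ((h2 * k2) ·[rho] a)) /\
  (* (19) *)
  (forall h k : H,
    varsigma (h ⊗ k) =
    \sw_(h1, h2 <- h) \sw_(k1, k2 <- k)
      varsigma (h1 ⊗ k1) * ((h2 * k2) ·[rho] 1)) /\
  (* (20) *)
  (forall h : H,
    (h ·[rho] 1) =
    \sw_(h1, h2 <- h) \sw_(u1, u2 <- 1)
      (h1 ·[rho] (u1 ·[rho] 1)) * varsigma (h2 ⊗ u2)) /\
  (* (21) *)
  (forall h : H,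
    h ·[rho] 1 = \sw_(u1, u2 <- 1) (u1 ·[rho] 1) * varsigma (u2 ⊗ h)) /\
  (* (22) *)
  (forall a : A,
    \sw_(u1, u2 <- 1) (a * (u1 ·[rho] 1)) ⊗ u2 =
    \sw_(u1, u2 <- 1) (u1 ·[rho] a) ⊗ u2 :> A ⊗ H).
Proof.
have cocycle_recover h k :
    \sw_(h1, h2 <- h) \sw_(k1, k2 <- k)
      (h1 ·[rho] (k1 ·[rho] 1)) * sigma (h2 ⊗R k2) = sigma (h ⊗R k).
  (* With the sum over k outermost, (6) applies to each inner sum over h, with l = Pi^L(k1). *)
  rewrite exchange_sw; [|multilinear..].
  rewrite -[in RHS](sw_PiL_mul k).
  rewrite (sw_linear (L := fun x : H => sigma (h ⊗R x))); [|multilinear..].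
  by apply: eq_sw => a b; rewrite H1 -H6 //; exists a.
split=> //; split=> //; split.
  (* (11): h . (k . 1) = h Pi^L(k) . 1, and this depends only on Pi^L(h Pi^L(k)) = Pi^L(hk). *)
  move=> h k; rewrite (H1 k) H10; last by exists k.
  by rewrite H1 PiL_mul_PiL -H1.
split; first exact: H8.
split; first exact: H9.
(* (9) at a = 1 turns the right side of (19) into the sum just evaluated. *)
split; first by move=> h k; rewrite -[RHS]H9 -[LHS]cocycle_recover.
split; first by move=> h; rewrite [RHS]cocycle_recover (H7 h).2.
split.
  (* (21): write h . 1 as sigma(1, h), expand 1 as Pi^L(1_1) 1_2, and pull Pi^L(1_1) out by (5). *)
  move=> h; rewrite -(H7 h).1 -[in LHS](sw_PiL_mul 1).
  rewrite (sw_linear (L := fun x : H => sigma (x ⊗R h))); [|multilinear..].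
  by apply: eq_sw => a b; rewrite H1 -(H5 _ _ _ _).1 //; exists a.
move=> a.
rewrite -(sw1_PiR (f := fun u v : H => (a * (u ·[rho] 1)) ⊗ v));
  last by multilinear.
rewrite -[RHS](sw1_PiR (f := fun u v : H => (u ·[rho] a) ⊗ v));
  last by multilinear.
apply: eq_sw => u v; congr (_ ⊗ _).
(* With a = 1 . a, condition (3) is used at h = 1 and l = Pi^L(r), where r = Pi^R(u) and S^-1(l) =
   r. *)
rewrite H1 -{1}(H4 a) -(H3 _ _ _ _).1; last by exists (PiR u).
by rewrite mulr1 -antipode_PiR SK.
Qed.
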